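(* For a positive integer $k$, let $m_k$ denote the minimum order of a connected graph $G$ with $c(G)\geq k$. Then: (1) $m_k = O(k^2)$ as $k\to\infty$. (2) The following two statements are equivalent: (i) (Meyniel's conjecture) there is a constant $d>0$ such that every connected graph $G$ of order $n$ satisfies $c(G)\leq d\sqrt{n}$; (ii) $m_k=\Omega(k^2)$ as $k\to\infty$.
   Context: Cops and Robbers is played on a finite, connected, undirected graph $G$. Cops first each choose a starting vertex, then the robber does; thereafter players alternate rounds, cops first, each player moving to an adjacent vertex or staying put (several cops may share a vertex). The cops win if some cop eventually occupies the robber's vertex. The cop number $c(G)$ is the minimum number of cops that have a winning strategy. *)

(* Defs.v *)
From HB Require Import structures.
From mathcomp Require Import all_boot all_order all_algebra.
From mathcomp Require Import boolp classical_sets reals topology normedtype landau.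

Set Implicit Arguments.
Unset Strict Implicit.
Unset Printing Implicit Defensive.

Import Order.TTheory GRing.Theory Num.Theory.
Import numFieldNormedType.Exports.

Record graph := Graph {
  vertex :> finType;
  adj : rel vertex;
  adj_sym : symmetric adj;
  adj_irr : irreflexive adj
}.

Definition graph_order (G : graph) : nat := #|vertex G|.

Definition connected_graph (G : graph) : Prop :=
  0 < graph_order G /\ forall x y : G, connect (@adj G) x y.

Definition legal_move (G : graph) (x y : G) : Prop := x = y \/ adj x y.

(* A strategy of [k] cops maps the list of the robber's positions so far, in
   chronological order, to the current positions of the cops: [s [::]] is the
   initial placement, chosen before the robber's, and [s [:: r_0; ...; r_t]] is
   the position of the cops after their answer to the robber being at [r_t]. *)
Definition cop_strategy (G : graph) (k : nat) := seq G -> 'I_k -> G.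

Definition legal_strategy (G : graph) (k : nat) (s : cop_strategy G k) : Prop :=
  forall (h : seq G) (x : G) (i : 'I_k), legal_move (s h i) (s (rcons h x) i).

Definition robber_play (G : graph) (r : nat -> G) : Prop :=
  forall t, legal_move (r t) (r t.+1).

(* The two cases are a meeting right after the robber's arrival at [r t], and
   right after the answer of the cops. *)
Definition captures (G : graph) (k : nat) (s : cop_strategy G k)
    (r : nat -> G) : Prop :=
  exists (t : nat) (i : 'I_k),
    s (mkseq r t) i = r t \/ s (mkseq r t.+1) i = r t.

Definition cops_win (G : graph) (k : nat) : Prop :=
  exists s : cop_strategy G k,
    legal_strategy s /\ forall r, robber_play r -> captures s r.

Lemma cops_win_order (G : graph) : cops_win G (graph_order G).
Proof.
exists (fun _ => @enum_val G (mem predT)); split=> [h x i|r _]; first by left.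
by exists 0, (enum_rank (r 0)); left; rewrite enum_rankK.
Qed.

Lemma ex_cops_win (G : graph) : exists k, `[< cops_win G k >].
Proof. by exists (graph_order G); apply/asboolP; apply: cops_win_order. Qed.

Definition cop_number (G : graph) : nat := ex_minn (ex_cops_win G).

Definition is_min_order (k n : nat) : Prop :=
  (exists G : graph, [/\ connected_graph G, k <= cop_number G & graph_order G = n]) /\
  (forall G : graph, connected_graph G -> k <= cop_number G -> n <= graph_order G).

(* Meaningful only together with [is_min_order k (min_order k)]: the default
   value is [0] if no connected graph has cop number at least [k]. *)
Definition min_order (k : nat) : nat := xget 0 [set n | is_min_order k n]%classic.

Local Open Scope ring_scope.

Definition meyniel_conjecture (R : realType) : Prop :=
  exists2 d : R, 0 < d &
    forall G : graph, connected_graph G ->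
      (cop_number G)%:R <= d * Num.sqrt (graph_order G)%:R.

(* Main.v *)
Require Import Defs.
From mathcomp Require Import all_boot all_order all_algebra.
From mathcomp Require Import finfield ring.
From mathcomp Require Import boolp classical_sets reals topology normedtype landau.

(** In a graph without cycles of length 3 or 4, the closed neighbourhood of a
    vertex [c <> u] contains at most one neighbour of [u].  Fewer cops than the
    minimum degree therefore always leave the robber a neighbour that no cop can
    reach in one move, so the cop number is at least the minimum degree.  The
    incidence graph of the points and the non-vertical lines of the affine plane
    over the field with [q] elements is connected, [q]-regular, without such
    cycles, and has [2 q^2] vertices; taking for [q] the power of two with
    [k < q <= 2 k] gives [m_k <= 8 k^2].  Meyniel's bound [k <= d sqrt n] reads
    [k^2 <= d^2 n], that is [k^2 <= d^2 m_k] for all [k]; asking for the latter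
    only when [k] is large is no weaker, because the finitely many exceptions
    are absorbed in the constant. *)

Set Implicit Arguments.
Unset Strict Implicit.
Unset Printing Implicit Defensive.

Import Order.TTheory GRing.Theory Num.Theory.
Import numFieldNormedType.Exports.

Lemma leq_card_bigcup (I T : finType) (B : I -> {set T}) :
  #|\bigcup_i B i| <= \sum_i #|B i|.
Proof.
elim/big_ind2: _ => [|n1 A1 n2 A2 leA1 leA2|//]; first by rewrite cards0.
exact: leq_trans (leq_card_setU A1 A2).1 (leq_add leA1 leA2).
Qed.

Lemma exists_notin_bigcup (I T : finType) (A : {set T}) (B : I -> {set T})
    (m : nat) :
  (forall i, #|A :&: B i| <= m) -> #|I| * m < #|A| ->
  exists2 x, x \in A & x \notin \bigcup_i B i.
Proof.
move=> meetB ltA; apply/fintype.subsetPn; apply: contraL ltA => /finset.setIidPl AB.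
rewrite -leqNgt -AB big_distrr /= -sum_nat_const.
by apply: leq_trans (leq_card_bigcup _) _; apply: leq_sum.
Qed.

Lemma exists_notin_codom (I T : finType) (f : I -> T) :
  #|I| < #|T| -> exists x, x \notin codom f.
Proof.
move=> ltIT; have /fintype.subsetPn[x _ xf] : ~~ ([set: T] \subset codom f).
  apply: contraL ltIT => /subset_leq_card; rewrite cardsT -leqNgt => leT.
  exact: leq_trans leT (leq_image_card f I).
by exists x.
Qed.

Lemma mkseq_rec (T : Type) (f : seq T -> T) :
  exists r : nat -> T, forall n, r n = f (mkseq r n).
Proof.
pose fix hist n := if n is m.+1 then rcons (hist m) (f (hist m)) else [::].
exists (fun n => f (hist n)) => n; congr f.
by elim: n => // n IHn; rewrite mkseqS -IHn.
Qed.

Lemma cop_numberP (G : graph) : cops_win G (cop_number G).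
Proof. by rewrite /cop_number; case: ex_minnP => k /asboolP. Qed.

Section Evasion.
Variable G : graph.

Definition neighbours (x : G) : {set G} := [set y | adj x y].

Definition closed_neighbours (x : G) : {set G} := x |: neighbours x.

Definition guarded (k : nat) (c : 'I_k -> G) : {set G} :=
  \bigcup_i closed_neighbours (c i).

Definition robber_can_escape (k : nat) : Prop :=
  forall (c : 'I_k -> G) (u : G), u \notin codom c ->
    exists2 v, v \in closed_neighbours u & v \notin guarded c.

Lemma legal_moveP (x y : G) : reflect (legal_move x y) (y \in closed_neighbours x).
Proof.
by rewrite !inE eq_sym; apply: (iffP orP) => -[/eqP|]; by [left | right].
Qed.

Lemma codom_sub_guarded (k : nat) (c : 'I_k -> G) : {subset codom c <= guarded c}.
Proof.
by move=> _ /codomP[i ->]; apply/finset.bigcupP; exists i; rewrite // setU11.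
Qed.

Lemma notin_guarded_legal (k : nat) (s : cop_strategy G k) (h : seq G) (x : G) :
  legal_strategy s -> x \notin guarded (s h) -> x \notin codom (s (rcons h x)).
Proof.
move=> s_legal; apply: contra => /codomP[i xE]; apply/finset.bigcupP; exists i => //.
by rewrite {1}xE; apply/legal_moveP/s_legal.
Qed.

Lemma escape_not_cops_win (k : nat) :
  k < graph_order G -> robber_can_escape k -> ~ cops_win G k.
Proof.
move=> ltkG can_escape [s [s_legal s_wins]].
have [|u0 free0] := exists_notin_codom (s [::]); first by rewrite card_ord.
pose safe_moves h := closed_neighbours (last u0 h) :\: guarded (s h).
have [r rE] := mkseq_rec (fun h => odflt u0 [pick v in safe_moves h]).
pose robber t := last u0 (mkseq r t).
have robberS t : robber t.+1 = r t by rewrite /robber mkseqS last_rcons.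
have r_safe t : robber t \notin codom (s (mkseq r t)) ->
    r t \in closed_neighbours (robber t) :\: guarded (s (mkseq r t)).
  move=> free; rewrite rE; case: pickP => // stuck.
  have [v uv vc] := can_escape _ _ free.
  by have := stuck v; rewrite finset.in_setD vc uv.
have free t : robber t \notin codom (s (mkseq r t)).
  elim: t => // t /r_safe/finset.setDP[_ unguarded].
  by rewrite robberS mkseqS; apply: notin_guarded_legal.
have [t|t [i [caught|caught]]] := s_wins r.
- by have /finset.setDP[/legal_moveP] := r_safe _ (free t.+1); rewrite robberS.
- have /finset.setDP[_ /negP[]] := r_safe _ (free t).
  by apply: codom_sub_guarded; rewrite -caught codom_f.
- by have := free t.+1; rewrite robberS -caught codom_f.
Qed.

End Evasion.

Definition triangle_free (G : graph) : Prop :=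
  forall x y z : G, adj x y -> adj y z -> ~~ adj x z.

Definition square_free (G : graph) : Prop :=
  forall x y u v : G, adj x u -> adj x v -> adj y u -> adj y v -> x = y \/ u = v.

Lemma card_common_neighbours (G : graph) (u c : G) :
  triangle_free G -> square_free G -> c != u ->
  #|neighbours u :&: closed_neighbours c| <= 1.
Proof.
move=> tri sq cu; apply/card_le1_eqP => v w; rewrite !inE.
move=> /andP[uv /predU1P[vc|cv]] /andP[uw /predU1P[wc|cw]].
- by rewrite vc.
- by rewrite (negPf (tri u v w uv _)) ?vc in uw.
- by rewrite (negPf (tri u w v uw _)) ?wc in uv.
- by have [uc|//] := sq u c v w uv uw cv cw; rewrite uc eqxx in cu.
Qed.

Lemma cop_number_ge_degree (G : graph) (d : nat) :
  triangle_free G -> square_free G -> 0 < graph_order G ->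
  (forall u : G, d <= #|neighbours u|) -> d <= cop_number G.
Proof.
move=> tri sq /card_gt0P[x _] deg; rewrite leqNgt; apply/negP => cops_lt.
apply: escape_not_cops_win (cop_numberP G).
  exact: leq_trans cops_lt (leq_trans (deg x) (max_card _)).
move=> c u uc; have cu i : c i != u by apply: contraNneq uc => <-; apply: codom_f.
have [||v uv] :=
  @exists_notin_bigcup _ _ (neighbours u) (fun i => closed_neighbours (c i)) 1.
- by move=> i; apply: card_common_neighbours.
- by rewrite card_ord muln1; apply: leq_trans cops_lt (deg u).
by exists v => //; rewrite finset.in_setU uv orbT.
Qed.

Section IncidenceGraph.
Variables (P L : finType) (incident : P -> L -> bool).

Definition incidence (u v : P + L) : bool :=
  match u, v with
  | inl p, inr l | inr l, inl p => incident p l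
  | _, _ => false
  end.

Lemma incidence_sym : symmetric incidence.
Proof. by move=> [?|?] [?|?]. Qed.

Lemma incidence_irr : irreflexive incidence.
Proof. by case. Qed.

Definition incidence_graph : graph := Graph incidence_sym incidence_irr.

Lemma incidence_graph_order : graph_order incidence_graph = #|P| + #|L|.
Proof. exact: card_sum. Qed.

Lemma incidence_graph_triangle_free : triangle_free incidence_graph.
Proof. by move=> [?|?] [?|?] [?|?]. Qed.

Lemma card_neighbours_point (p : P) :
  #|neighbours (inl p : incidence_graph)| = #|[set l | incident p l]|.
Proof.
rewrite -(card_imset _ (@inr_inj P L)); apply: eq_card => -[q|l].
  by rewrite !inE; apply/esym/imsetP => -[].
by rewrite mem_imset ?inE //; apply: inr_inj.
Qed.

Lemma card_neighbours_line (l : L) :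
  #|neighbours (inr l : incidence_graph)| = #|[set p | incident p l]|.
Proof.
rewrite -(card_imset _ (@inl_inj P L)); apply: eq_card => -[p|m].
  by rewrite mem_imset ?inE //; apply: inl_inj.
by rewrite !inE; apply/esym/imsetP => -[].
Qed.

Hypothesis incident_uniq : forall p q l m,
  incident p l -> incident p m -> incident q l -> incident q m -> p = q \/ l = m.

Lemma incidence_graph_square_free : square_free incidence_graph.
Proof.
move=> [p|l] [q|m] [u|u] [v|v] //= xu xv yu yv.
  by have [->|->] := incident_uniq xu xv yu yv; [left | right].
by have [->|->] := incident_uniq xu yu xv yv; [right | left].
Qed.

Lemma cop_number_incidence_graph (d : nat) : 0 < #|P| ->
  (forall p, d <= #|[set l | incident p l]|) ->
  (forall l, d <= #|[set p | incident p l]|) -> d <= cop_number incidence_graph.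
Proof.
move=> P0 deg_point deg_line; apply: cop_number_ge_degree.
- exact: incidence_graph_triangle_free.
- exact: incidence_graph_square_free.
- by rewrite incidence_graph_order ltn_addr.
- by case=> [p|l]; rewrite ?card_neighbours_point ?card_neighbours_line.
Qed.

End IncidenceGraph.

Local Open Scope ring_scope.

Section AffinePlane.
Variable F : finFieldType.
Implicit Types p l : F * F.

(* The pair [(m, b)] stands for the line [y = m x - b]: with this sign of [b],
   points and lines play symmetric roles. *)
Definition on_line p l : bool := p.2 + l.2 == p.1 * l.1.

Lemma on_lineC p l : on_line p l = on_line l p.
Proof. by rewrite /on_line addrC mulrC. Qed.

Lemma on_line_uniq p p' l l' :
  on_line p l -> on_line p l' -> on_line p' l -> on_line p' l' -> p = p' \/ l = l'.
Proof.
case: p p' l l' => [x y] [x' y'] [m b] [m' b']; rewrite /on_line /=.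
move=> /eqP xm /eqP xm' /eqP x'm /eqP x'm'.
have /eqP : (x - x') * (m - m') = 0.
  transitivity (x * m - x * m' - x' * m + x' * m'); first by ring.
  by rewrite -xm -xm' -x'm -x'm'; ring.
rewrite mulf_eq0 !subr_eq0 => /orP[/eqP xx' | /eqP mm']; [left | right].
  by congr (_, _) => //; apply: (@addIr _ b); rewrite xm x'm xx'.
by congr (_, _) => //; apply: (@addrI _ y); rewrite xm xm' mm'.
Qed.

Lemma card_points_on_line l : #|[set p | on_line p l]| = #|F|.
Proof.
pose point (x : F) := (x, x * l.1 - l.2).
have point_inj : injective point by move=> ? ? [].
rewrite -[RHS]cardsT -(card_imset _ point_inj); apply: eq_card => -[x y].
rewrite inE /on_line /=; apply/eqP/imsetP => [xy|[x' _ [-> ->]]]; last exact: subrK.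
by exists x; rewrite // /point -xy addrK.
Qed.

Definition affine_plane : graph := incidence_graph on_line.

Lemma affine_plane_order : graph_order affine_plane = (2 * #|F| ^ 2)%N.
Proof. by rewrite incidence_graph_order card_prod mulnn mul2n addnn. Qed.

Lemma affine_plane_connected : connected_graph affine_plane.
Proof.
have F0 : (0 < #|F|)%N := ltnW (card_finNzRing_gt1 F).
split; first by rewrite affine_plane_order muln_gt0 expn_gt0 F0.
pose o : affine_plane := inl (0, 0).
have nonvertical x y : x != 0 -> connect (@adj affine_plane) (inl (x, y)) o.
  move=> x0; apply: (@connect_trans _ _ (inr (y / x, 0))); apply: connect1.
    by rewrite /= /on_line /= addr0 mulrC divfK.
  by rewrite /= /on_line /= addr0 mul0r.
have line m b : connect (@adj affine_plane) (inr (m, b)) o.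
  apply: connect_trans (nonvertical 1 (m - b) (oner_neq0 _)); apply: connect1.
  by rewrite /= /on_line /= subrK mul1r.
have to_origin u : connect (@adj affine_plane) u o.
  case: u => [[x y]|[m b]]; last exact: line.
  have [->|/nonvertical//] := eqVneq x 0.
  apply: connect_trans (line 0 (- y)); apply: connect1.
  by rewrite /= /on_line /= subrr mul0r.
move=> u v; apply: connect_trans (to_origin u) _.
by rewrite (sym_connect_sym (@adj_sym affine_plane)).
Qed.

Lemma cop_number_affine_plane : (#|F| <= cop_number affine_plane)%N.
Proof.
apply: (cop_number_incidence_graph on_line_uniq).
- by apply/card_gt0P; exists (0, 0).
- move=> p; rewrite -(card_points_on_line p).
  by apply/subset_leq_card/fintype.subsetP => l; rewrite !inE on_lineC.
- by move=> l; rewrite card_points_on_line.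
Qed.

End AffinePlane.

Lemma exists_finField_card_between (k : nat) : (0 < k)%N ->
  exists F : finFieldType, (k < #|F| <= 2 * k)%N.
Proof.
move=> k0; have /andP[le_k lt_k] := @trunc_log_bounds 2 k isT k0.
have [F _ cardF] := @pPrimePowerField 2 (trunc_log 2 k).+1 isT isT.
by exists F; rewrite cardF lt_k expnS leq_mul2l.
Qed.

Lemma exists_large_cop_number (k : nat) : (0 < k)%N -> exists G : graph,
  [/\ connected_graph G, (k <= cop_number G)%N & (graph_order G <= 8 * k ^ 2)%N].
Proof.
move=> /exists_finField_card_between[F /andP[ltk le2k]]; exists (affine_plane F); split.
- exact: affine_plane_connected.
- exact: leq_trans (ltnW ltk) (cop_number_affine_plane F).
- by rewrite affine_plane_order -(mulnA 2 4) leq_mul2l /= -(expnMn 2 k 2) leq_exp2r.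
Qed.

Lemma min_orderP (k : nat) : is_min_order k (min_order k).
Proof.
apply: (@xgetPex _ 0%N [set n | is_min_order k n]%classic).
pose attained n := `[< exists G : graph,
  [/\ connected_graph G, (k <= cop_number G)%N & graph_order G = n] >].
have : exists n, attained n.
  have [G [connG ltkG _]] := @exists_large_cop_number k.+1 isT.
  by exists (graph_order G); apply/asboolP; exists G; split=> //; apply: ltnW.
move=> /ex_minnP[n /asboolP n_attained n_min]; exists n; split=> // G connG lekG.
by apply: n_min; apply/asboolP; exists G.
Qed.

Lemma min_order_le_square (k : nat) : (0 < k)%N -> (min_order k <= 8 * k ^ 2)%N.
Proof.
move=> /exists_large_cop_number[G [connG lekG]].
exact: leq_trans ((min_orderP k).2 G connG lekG).
Qed.

Lemma min_order_gt0 (k : nat) : (0 < min_order k)%N.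
Proof. by have [[G [[G0 _] _ <-]] _] := min_orderP k. Qed.

Local Open Scope classical_set_scope.
Local Open Scope ring_scope.

Lemma eqO_natP (K : numFieldType) (V W : normedModType K)
    (u : nat -> V) (v : nat -> W) :
  (forall n, v n = 0 -> u n = 0) ->
  u =O_\oo v <-> exists2 C : K, 0 < C & forall n, `|u n| <= C * `|v n|.
Proof.
move=> supp; split=> [/eqO_exP[C C0 [N _ large]] | [C C0 bound]]; last first.
  by apply/eqO_exP; exists C => //; exists 0%N.
pose ratio n := `|u n| / `|v n|.
have ratio_ge0 n : 0 <= ratio n by rewrite divr_ge0.
have sum_ge0 : 0 <= \sum_(i < N) ratio i by apply: sumr_ge0.
exists (C + \sum_(i < N) ratio i); first by rewrite ltr_wpDr.
move=> n; rewrite mulrDl; have [leNn|ltnN] := leqP N n.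
  by apply: ler_wpDr; [rewrite mulr_ge0 | apply: large].
apply: ler_wpDl; first by rewrite mulr_ge0 // ltW.
have [vn0|vn0] := eqVneq (v n) 0; first by rewrite supp // vn0 !normr0 mulr0.
rewrite -[X in X <= _](divfK (x := `|v n|)) ?normr_eq0 // ler_wpM2r //.
by rewrite (bigD1 (Ordinal ltnN)) //= ler_wpDr // sumr_ge0.
Qed.

Section Asymptotics.
Variable R : realType.

Definition min_order_ge_quadratic : Prop :=
  exists2 C : R, 0 < C & forall k, k%:R ^+ 2 <= C * (min_order k)%:R.

Lemma min_order_bigO :
  (fun k : nat => (min_order k)%:R : R) =O_\oo (fun k : nat => k%:R ^+ 2 : R).
Proof.
apply/eqO_exP; exists 8 => //; exists 1%N => // k k0 /=.
by rewrite !ger0_norm ?exprn_ge0 // -natrX -natrM ler_nat min_order_le_square.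
Qed.

Lemma min_order_bigOmegaP :
  (fun k : nat => (min_order k)%:R : R) =Omega_\oo (fun k : nat => k%:R ^+ 2 : R) <->
  min_order_ge_quadratic.
Proof.
rewrite eqOmegaE eqOmegaO eqO_natP => [|k /eqP]; last first.
  by rewrite pnatr_eq0 eqn0Ngt min_order_gt0.
by split=> -[C C0 bound]; exists C => // k; have := bound k;
  rewrite !ger0_norm ?exprn_ge0.
Qed.

Lemma meyniel_conjectureP : meyniel_conjecture R <-> min_order_ge_quadratic.
Proof.
split=> [[d d0 meyniel]|[C C0 bound]].
  exists (d ^+ 2) => [|k]; first exact: exprn_gt0.
  have [[G [connG lekG <-]] _] := min_orderP k.
  rewrite -[X in _ * X]sqr_sqrtr // -exprMn.
  rewrite lerXn2r ?nnegrE ?mulr_ge0 ?sqrtr_ge0 ?(ltW d0) //.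
  by apply: le_trans (meyniel G connG); rewrite ler_nat.
exists (Num.sqrt C) => [|G connG]; first by rewrite sqrtr_gt0.
rewrite -sqrtrM ?(ltW C0) // -[X in X <= _]ger0_norm // -sqrtr_sqr ler_wsqrtr //.
apply: le_trans (bound _) _; rewrite ler_pM2l // ler_nat.
exact: (min_orderP _).2.
Qed.

End Asymptotics.

Theorem theorem3 (R : realType) :
  (forall k : nat, (0 < k)%N -> is_min_order k (min_order k)) /\
  (fun k : nat => (min_order k)%:R : R) =O_\oo (fun k : nat => k%:R ^+ 2 : R) /\
  (meyniel_conjecture R <->
    (fun k : nat => (min_order k)%:R : R) =Omega_\oo (fun k : nat => k%:R ^+ 2 : R)).
Proof.
split=> [k _|]; first exact: min_orderP.
split; first exact: min_order_bigO.
exact: iff_trans (meyniel_conjectureP R) (iff_sym (min_order_bigOmegaP R)).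
Qed.
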